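(* Given $M$ vectors in $\mathbb{R}^N$ arranged as the rows of a matrix $A\in\mathbb{R}^{M\times N}$, the sum of squared volumes of the parallelepipeds formed by the size-$n$ subsets of the rows satisfies $$\mathrm{vol}_n=\sum_{i=1}^{\binom{M}{n}}v_n^2(i)=\frac{\operatorname{Tr}\Phi_n}{n},$$ where $n\ge1$ and $\Phi_n$ is the total quasi projector of the rows of $A$.
   Context: The index $i$, $1\le i\le\binom{M}{n}$, enumerates the $n$-element subsets of the row indices $\{1,\dots,M\}$ of $A$; $A_n(i)\in\mathbb{R}^{n\times N}$ is the submatrix of $A$ formed by the rows in the $i$-th subset, and $G_n(i)=A_n(i)A_n(i)^T$. The squared volume is $v_n^2(i)=\det G_n(i)$ (the square of the $n$-volume of the parallelepiped formed by the chosen rows). The quasi projector is $Q_n(i)=A_n(i)^T\,\mathrm{adj}(G_n(i))\,A_n(i)$, where $\mathrm{adj}$ denotes the adjugate matrix (the adjugate of a $1\times1$ matrix is $1$). The total quasi projector is $\Phi_n:=\sum_{i=1}^{\binom{M}{n}}Q_n(i)$. *)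

(* Defs.v *)
From mathcomp Require Import all_boot all_order all_algebra.

Set Implicit Arguments.
Unset Strict Implicit.
Unset Printing Implicit Defensive.

Import GRing.Theory Num.Theory.
Local Open Scope ring_scope.

(* The indices i = 1, ..., 'C(M, n) are represented by the
   n-element subsets S of 'I_M themselves. *)

Section QuasiProjector.

Variables (R : realFieldType) (M N : nat).
Implicit Types (A : 'M[R]_(M, N)) (S : {set 'I_M}).

(* [enum_val] lists S in increasing order, so the rows keep the order they have
   in A; the row dimension is literally #|S|, which avoids a cast to n. *)
Definition subrows A S : 'M[R]_(#|S|, N) :=
  rowsub (fun k : 'I_#|S| => enum_val k) A.

Definition gram A S : 'M[R]_#|S| := subrows A S *m (subrows A S)^T.

(* Gram determinant: the square of the #|S|-volume of the parallelepiped spanned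
   by the rows in S. *)
Definition sqvol A S : R := \det (gram A S).

(* For #|S| = 1, [\adj] of the 1 x 1 Gram matrix is 1, since its only cofactor
   is the determinant of a 0 x 0 matrix. *)
Definition quasi_proj A S : 'M[R]_N :=
  (subrows A S)^T *m \adj (gram A S) *m subrows A S.

Definition total_quasi_proj (n : nat) A : 'M[R]_N :=
  \sum_(S : {set 'I_M} | #|S| == n) quasi_proj A S.

Definition vol (n : nat) A : R :=
  \sum_(S : {set 'I_M} | #|S| == n) sqvol A S.

End QuasiProjector.

(* Main.v *)
Require Import Defs.
From mathcomp Require Import all_boot all_order all_algebra.

Set Implicit Arguments.
Unset Strict Implicit.
Unset Printing Implicit Defensive.

Import GRing.Theory Num.Theory.
Local Open Scope ring_scope.

(** With [B := subrows A S] and [G := B *m B^T], cyclicity of the trace turns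
    [\tr (B^T *m \adj G *m B)] into [\tr (G *m \adj G)], the trace of the scalar matrix [\det G] of
    size [#|S|]. Summing over the subsets of size [n] gives [n] times the volume sum. *)

Lemma mxtrace_quasi_proj (R : realFieldType) (M N : nat) (A : 'M[R]_(M, N))
    (S : {set 'I_M}) :
  \tr (quasi_proj A S) = sqvol A S *+ #|S|.
Proof. by rewrite mxtrace_mulC mulmxA mul_mx_adj mxtrace_scalar. Qed.

Theorem theorem2 (R : realFieldType) (M N n : nat) (A : 'M[R]_(M, N))
    (hn : (1 <= n)%N) :
  vol n A = \sum_(S : {set 'I_M} | #|S| == n) sqvol A S /\
  \sum_(S : {set 'I_M} | #|S| == n) sqvol A S
    = \tr (total_quasi_proj n A) / n%:R.
Proof.
split=> //; rewrite raddf_sum mulr_suml; apply: eq_bigr => S /eqP cardS.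
(* Cancelling [n%:R] uses [hn] and characteristic 0. *)
by rewrite /= mxtrace_quasi_proj cardS -[sqvol A S *+ n]mulr_natr mulfK // pnatr_eq0 -lt0n.
Qed.
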